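(* Let $N\in\mathbb{N}$. (I) Glue is a nilpotent ideal, meaning that for each $n$ the glue subset of the algebra $\mathsf{Match}_g^N(n,n)$ (the set of matrices in $\mathsf{Match}_g^N(n,n)$ whose entries in all charge-conserving positions vanish) is a nilpotent ideal. Thus for $N,n>1$ the algebra $\mathsf{Match}_g^N(n,n)$ is non-semisimple. Furthermore, any subalgebra $M\subseteq \mathsf{Match}_g^N(n,n)$ with $\dim(M)>\dim(K(M))$ is non-semisimple. (II) If $\rho:\mathsf{A}\to\mathsf{Match}_g^N(n,n)$ is a representation of an algebra $\mathsf{A}$, then so is the de-gluing $K\circ\rho$; and the image $(K\circ\rho)(\mathsf{A})$ is a quotient of $\rho(\mathsf{A})$ by part (or all) of the radical. In particular, the irreducible factors of $\rho(\mathsf{A})$ and $(K\circ\rho)(\mathsf{A})$ are the same.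
   Context: Fix a ground field $k$ (one may take $k=\mathbb{C}$); algebras are over $k$. $\underline{N}=\{1,\dots,N\}$ and $\underline{N}^n$ is the set of words of length $n$. $\mathsf{Mat}^N(n,n)$ is the algebra of matrices over $k$ with rows and columns labelled by $\underline{N}^n$; the entry in row $w$, column $v$ is $\langle w|M|v\rangle$. $\Lambda^N_n=\{\lambda\in\mathbb{N}_0^N:\sum_i\lambda_i=n\}$, and $\mathsf{f}:\underline{N}^n\to\Lambda^N_n$ is $\mathsf{f}(w)_i=|\{j:w_j=i\}|$. The total order $<$ on $\Lambda^N_n$: order $\underline{N}^n$ by reverse lexicographic order, in which earlier letters change quickest ($w$ precedes $v$ if $w_j<v_j$ at the largest position $j$ where they differ); then $\lambda<\mu$ if the first word $w$ with $\mathsf{f}(w)=\lambda$ precedes the first word $v$ with $\mathsf{f}(v)=\mu$. $\mathsf{Match}_g^N(n,n)$ is the algebra of charge-conserving-with-glue (CCwg) matrices: those $M\in\mathsf{Mat}^N(n,n)$ such that $\langle w|M|v\rangle\ne0$ implies $\mathsf{f}(w)\le\mathsf{f}(v)$. Positions $(w,v)$ with $\mathsf{f}(w)<\mathsf{f}(v)$ are called glue positions; positions with $\mathsf{f}(w)=\mathsf{f}(v)$ are called charge-conserving (CC) positions. $\mathsf{Match}^N(n,n)$ is the set of $M\in\mathsf{Mat}^N(n,n)$ with $\langle w|M|v\rangle\neq0$ only if $\mathsf{f}(w)=\mathsf{f}(v)$. The de-gluing map $K:\mathsf{Match}_g^N(n,n)\to\mathsf{Match}^N(n,n)$ is the linear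 map setting all entries in glue positions to zero and leaving the CC positions unchanged. *)

(* Defs.v *)
From HB Require Import structures.
From mathcomp Require Import all_boot all_order all_fingroup all_algebra.
From mathcomp Require Import classical_sets.

Set Implicit Arguments.
Unset Strict Implicit.
Unset Printing Implicit Defensive.

Import GRing.Theory.
Local Open Scope classical_set_scope.
Local Open Scope ring_scope.

(** * Words, contents, and the order on contents *)

(* Letters and positions are numbered from 0: 'I_N stands for {1, ..., N}. *)
Definition word (N n : nat) := n.-tuple 'I_N.

Definition content_set (N n : nat) : Type :=
  {l : {ffun 'I_N -> nat} | (\sum_(i < N) l i)%N == n}.

Definition letter_count (N n : nat) (w : word N n) : {ffun 'I_N -> nat} :=
  [ffun i => #|[pred j : 'I_n | tnth w j == i]|].

Lemma letter_countP (N n : nat) (w : word N n) :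
  (\sum_(i < N) letter_count w i)%N == n.
Proof.
apply/eqP; rewrite -[RHS]card_ord -sum1_card.
rewrite (partition_big (tnth w) xpredT) //=.
by apply: eq_bigr => i _; rewrite ffunE -sum1_card; apply: eq_bigl => j.
Qed.

(* The map f of the source. *)
Definition content (N n : nat) (w : word N n) : content_set N n :=
  exist _ (letter_count w) (letter_countP w).

(* Strict reverse lexicographic order: j is the last position where the words
   differ. *)
Definition revlex (N n : nat) (w v : word N n) : bool :=
  [exists j : 'I_n, (tnth w j < tnth v j)%N &&
    [forall i : 'I_n, (j < i)%N ==> (tnth w i == tnth v i)]].

Definition first_word (N n : nat) (l : content_set N n) (w : word N n) : bool :=
  (content w == l) &&
  [forall v : word N n, (content v == l) ==> (v != w) ==> revlex w v].

Definition content_lt (N n : nat) (l m : content_set N n) : bool :=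
  [exists w : word N n, exists v : word N n,
     [&& first_word l w, first_word m v & revlex w v]].

Definition content_le (N n : nat) (l m : content_set N n) : bool :=
  (l == m) || content_lt l m.

(** * Matrices with rows and columns labelled by words *)

Notation wdim N n := #|{: word N n}|.

Definition entry (k : fieldType) (N n : nat) (M : 'M[k]_(wdim N n))
    (w v : word N n) : k :=
  M (enum_rank w) (enum_rank v).

Definition Matchg (k : fieldType) (N n : nat) : set 'M[k]_(wdim N n) :=
  [set M | forall w v, entry M w v != 0 -> content_le (content w) (content v)].

Definition Match (k : fieldType) (N n : nat) : set 'M[k]_(wdim N n) :=
  [set M | forall w v, entry M w v != 0 -> content w = content v].

Definition glue (k : fieldType) (N n : nat) : set 'M[k]_(wdim N n) :=
  [set M | Matchg M /\
           forall w v, content w = content v -> entry M w v = 0].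

(* The map K. It is defined on all matrices, but is only meaningful on Matchg,
   where every position that is not charge-conserving and may carry a nonzero
   entry is a glue position. *)
Definition deglue (k : fieldType) (N n : nat) (M : 'M[k]_(wdim N n)) :
    'M[k]_(wdim N n) :=
  \matrix_(i, j)
    if content_lt (content (enum_val i)) (content (enum_val j)) then 0
    else M i j.

Lemma deglue_is_linear (k : fieldType) (N n : nat) : linear (@deglue k N n).
Proof.
move=> a x y; apply/matrixP=> i j; rewrite !mxE.
by case: ifP => _ //; rewrite mulr0 addr0.
Qed.

HB.instance Definition _ (k : fieldType) (N n : nat) :=
  GRing.isLinear.Build k 'M[k]_(wdim N n) 'M[k]_(wdim N n) *:%R
    (@deglue k N n) (@deglue_is_linear k N n).

(** * Algebras of matrices: ideals, semisimplicity, radical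

   Throughout, B : set 'M[k]_d is meant to be a linear subspace of 'M[k]_d
   closed under multiplication. *)

Definition is_ideal (k : fieldType) (d : nat) (B I : set 'M[k]_d) : Prop :=
  [/\ I `<=` B,
      I 0,
      forall (a : k) x y, I x -> I y -> I (a *: x + y)
    & forall x b, I x -> B b -> I (b * x) /\ I (x * b)].

(* I ^ p = 0 for some p. *)
Definition is_nilpotent (k : fieldType) (d : nat) (I : set 'M[k]_d) : Prop :=
  exists p : nat, forall x : 'I_p -> 'M[k]_d,
    (forall i, I (x i)) -> \prod_(i < p) x i = 0.

Definition mul_closed (k : fieldType) (d : nat) (B : set 'M[k]_d) : Prop :=
  forall x y, B x -> B y -> B (x * y).

Definition left_ideal (k : fieldType) (d : nat) (B : set 'M[k]_d)
    (L : {vspace 'M[k]_d}) : Prop :=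
  [set` L] `<=` B /\ forall b x, B b -> x \in L -> b * x \in L.

Definition simple_left_ideal (k : fieldType) (d : nat) (B : set 'M[k]_d)
    (L : {vspace 'M[k]_d}) : Prop :=
  [/\ left_ideal B L, L <> 0%VS
    & forall L' : {vspace 'M[k]_d}, left_ideal B L' -> (L' <= L)%VS ->
        L' = 0%VS \/ L' = L].

Definition maximal_left_ideal (k : fieldType) (d : nat) (B : set 'M[k]_d)
    (L : {vspace 'M[k]_d}) : Prop :=
  [/\ left_ideal B L, [set` L] <> B
    & forall L' : {vspace 'M[k]_d}, left_ideal B L' -> (L <= L')%VS ->
        L' = L \/ [set` L'] = B].

(* The left regular module is a direct sum of simple modules. The identity e
   of B need not be the identity matrix. A finite-dimensional algebra without
   identity has a nonzero radical, hence is not semisimple in any usual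
   sense either. *)
Definition semisimple (k : fieldType) (d : nat) (B : set 'M[k]_d) : Prop :=
  (exists e, B e /\ forall x, B x -> e * x = x /\ x * e = x) /\
  (exists (r : nat) (L : 'I_r -> {vspace 'M[k]_d}),
     [/\ forall i, simple_left_ideal B (L i),
         directv (\sum_(i < r) L i)%VS
       & B = [set` (\sum_(i < r) L i)%VS]]).

(* Jacobson radical, for B with identity. *)
Definition radical (k : fieldType) (d : nat) (B : set 'M[k]_d) : set 'M[k]_d :=
  [set x | B x /\ forall L, maximal_left_ideal B L -> x \in L].

(* q restricts to a surjective algebra homomorphism from B onto C with
   kernel J, that is, q induces an isomorphism from B / J to C. *)
Definition quotient_map (k : fieldType) (d : nat) (q : 'M[k]_d -> 'M[k]_d)
    (B J C : set 'M[k]_d) : Prop :=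
  [/\ forall (a : k) x y, B x -> B y -> q (a *: x + y) = a *: q x + q y,
      forall x y, B x -> B y -> q (x * y) = q x * q y,
      q @` B = C
    & forall x, B x -> (q x = 0 <-> J x)].

(** * Representations and their irreducible factors

   A map rho : A -> 'M[k]_d makes the column space 'cV[k]_d a left module. *)

Definition submodule (k : fieldType) (A : Type) (d : nat) (rho : A -> 'M[k]_d)
    (U : {vspace 'cV[k]_d}) : Prop :=
  forall a u, u \in U -> rho a *m u \in U.

Definition irreducible_rep (k : fieldType) (A : Type) (d : nat)
    (rho : A -> 'M[k]_d) : Prop :=
  (0 < d)%N /\
  forall U : {vspace 'cV[k]_d}, submodule rho U -> U = 0%VS \/ U = fullv.

(* The factor module U1 / U0 is irreducible. *)
Definition irreducible_factor (k : fieldType) (A : Type) (d : nat)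
    (rho : A -> 'M[k]_d) (U0 U1 : {vspace 'cV[k]_d}) : Prop :=
  [/\ (U0 <= U1)%VS, U0 <> U1
    & forall W : {vspace 'cV[k]_d}, submodule rho W ->
        (U0 <= W)%VS -> (W <= U1)%VS -> W = U0 \/ W = U1].

(* s = [:: U_1; ...; U_r] encodes the series 0 = U_0 < U_1 < ... < U_r, with
   U_r the whole space. *)
Definition composition_series (k : fieldType) (A : Type) (d : nat)
    (rho : A -> 'M[k]_d) (s : seq {vspace 'cV[k]_d}) : Prop :=
  [/\ forall U, U \in s -> submodule rho U,
      forall i, (i < size s)%N ->
        irreducible_factor rho (nth 0%VS (0%VS :: s) i) (nth 0%VS s i)
    & last 0%VS s = fullv].

(* The factor modules U1 / U0 of rho and W1 / W0 of sigma are isomorphic.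
   Every linear map U1 / U0 -> W1 / W0 is induced by some endomorphism phi of
   the spaces, here required to be well defined and injective, surjective and
   A-linear modulo W0. *)
Definition factor_iso (k : fieldType) (A : Type) (d e : nat)
    (rho : A -> 'M[k]_d) (sigma : A -> 'M[k]_e)
    (U0 U1 : {vspace 'cV[k]_d}) (W0 W1 : {vspace 'cV[k]_e}) : Prop :=
  exists phi : 'Hom('cV[k]_d, 'cV[k]_e),
    [/\ (phi @: U1 <= W1)%VS,
        forall u, u \in U1 -> (phi u \in W0) = (u \in U0),
        (W1 <= phi @: U1 + W0)%VS
      & forall a u, u \in U1 -> phi (rho a *m u) - sigma a *m phi u \in W0].

(* Same composition factors, with multiplicities. Composition series always
   exist here, because the spaces are finite-dimensional. *)
Definition same_irreducible_factors (k : fieldType) (A : Type) (d e : nat)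
    (rho : A -> 'M[k]_d) (sigma : A -> 'M[k]_e) : Prop :=
  forall (s : seq {vspace 'cV[k]_d}) (t : seq {vspace 'cV[k]_e}),
    composition_series rho s -> composition_series sigma t ->
    size s = size t /\
    exists p : {perm 'I_(size s)}, forall i : 'I_(size s),
      factor_iso rho sigma
        (nth 0%VS (0%VS :: s) i) (nth 0%VS s i)
        (nth 0%VS (0%VS :: t) (p i)) (nth 0%VS t (p i)).

(* tau factors through the image algebra rho(A), i.e. tau is a representation
   of rho(A) pulled back along rho. *)
Definition factors_through (k : fieldType) (A : Type) (d m : nat)
    (rho : A -> 'M[k]_d) (tau : A -> 'M[k]_m) : Prop :=
  forall a, rho a = 0 -> tau a = 0.

(* Main.v *)
Require Import Defs.
From HB Require Import structures.
From mathcomp Require Import all_boot all_order all_fingroup all_algebra.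
From mathcomp Require Import classical_sets boolp.

Set Implicit Arguments.
Unset Strict Implicit.
Unset Printing Implicit Defensive.

Import GRing.Theory.
Local Open Scope classical_set_scope.
Local Open Scope ring_scope.

(** Counting the words of smaller content gives every word a height such that a glue
matrix has nonzero entries only from a word to one of strictly larger height.
Since heights are bounded by the number of words, a product of that many glue
matrices vanishes: glue is nilpotent ([glue_nilpotent]). On the CC positions a
product of two CCwg matrices only involves CC positions of the factors, because
the order on contents is a partial order; hence de-gluing is multiplicative
([deglue_mul]), and its kernel is glue ([deglue_eq0]).

Everything else follows from nilpotency through one observation
([nilpotent_annihilator]): if [I] is nilpotent and [U] a proper subspace of a
module, some vector outside [U] is sent into [U] by all of [I]. Whenever
[{v | I v <= U}] is a submodule, simplicity or maximality therefore forces it to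
be everything. With [U = 0] inside a simple left ideal this shows that a
semisimple algebra has no nonzero nilpotent ideal, which gives part (I); the
same argument with a maximal left ideal puts the glue part of an image into its
radical, and with an irreducible representation shows that such a representation
kills the kernel of the de-gluing.

For the composition factors, [rho a - K (rho a)] is glue. Let [U] be a subspace
invariant under both representations. On [U + {v | glue v <= U}] they agree modulo
[U], so a [rho]-submodule [W] between the two that is minimal among those strictly
containing [U] is invariant under both, and
[W / U] is the same irreducible module for both. Iterating gives a single series
which is a composition series of both representations with the same factors
([common_series_from]); the Jordan-Hoelder theorem ([jordan_holder]) then compares
it with any series of either one. *)

(** * Nilpotent ideals *)

(** Ideals, annihilators and colon spaces are described by predicates that are not
boolean; this turns them into subspaces. The witness is a subspace of maximal
dimension among those contained in [P]. *)
Lemma vspace_of_set (k : fieldType) (V : vectType k) (P : set V) :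
    P 0 -> (forall (a : k) x y, P x -> P y -> P (a *: x + y)) ->
  exists U : {vspace V}, forall x, x \in U <-> P x.
Proof.
move=> P0 Plin.
pose inP (U : {vspace V}) := forall x : V, x \in U -> P x.
pose dimP m := `[< exists U : {vspace V}, inP U /\ \dim U = m >].
have exP : exists m, dimP m.
  exists 0; apply/asboolP; exists 0%VS; split; last exact: dimv0.
  by move=> x; rewrite memv0 => /eqP->.
have leP m : dimP m -> (m <= \dim {:V})%N.
  by move=> /asboolP[U [_ <-]]; rewrite dimvS ?subvf.
case: (ex_maxnP exP leP) => m /asboolP[U [UP dU]] maxU.
exists U => x; split; first exact: UP.
move=> Px; apply: contrapT => /negP xU.
(* A vector of [P] outside [U] would allow [U] to be enlarged inside [P]. *)
suff /maxU : dimP (\dim (U + <[x]>)%VS).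
  by rewrite leqNgt -dU (ltn_leqif (dimv_leqif_sup (addvSl _ _)))
    subv_add subvv -memvE (negbTE xU).
apply/asboolP; exists (U + <[x]>)%VS; split=> // y.
move=> /memv_addP[u /UP Pu [_ /vlineP[a ->] ->]].
by rewrite addrC; apply: Plin.
Qed.

(** If every vector of [P] outside [U] were moved outside [U] by some element of [I],
then starting from [y] arbitrarily long products of elements of [I] would be
nonzero. Column vectors and square matrices under left multiplication are both
covered by letting [I] act on matrices with [c] columns. *)
Lemma nilpotent_annihilator (k : fieldType) (d c : nat) (I : set 'M[k]_d)
    (U : {vspace 'M[k]_(d, c)}) (P : set 'M[k]_(d, c)) y :
    is_nilpotent I -> (forall g v, I g -> P v -> P (g *m v)) ->
    P y -> y \notin U ->
  exists v, [/\ P v, v \notin U & forall g, I g -> g *m v \in U].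
Proof.
move=> [p nilI] IP Py yU; apply: contrapT => none.
have step v : P v -> v \notin U -> exists2 g, I g & g *m v \notin U.
  move=> Pv vU; apply: contrapT => nog; apply: none; exists v; split=> // g Ig.
  by apply: contrapT => /negP gvU; apply: nog; exists g.
have [x [Ix]] : exists x : nat -> 'M[k]_d, (forall i, (i < p)%N -> I (x i)) /\
    (\prod_(i < p) x i) *m y \notin U.
  elim: (p) y Py yU => [|q IHq] v Pv vU.
    by exists (fun=> 0); split=> //; rewrite big_ord0 mul1mx.
  have [g Ig gvU] := step v Pv vU.
  have [x [Ix xU]] := IHq _ (IP g v Ig Pv) gvU.
  exists (fun i => if i == q then g else x i); split=> [i|].
    by case: eqP => // /eqP ne; rewrite ltnS leq_eqVlt (negbTE ne) => /Ix.
  rewrite big_ord_recr /= eqxx -mulmxA.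
  by under eq_bigr => i _ do rewrite ltn_eqF //.
by rewrite (nilI (fun i : 'I_p => x i)) ?mul0mx ?mem0v // => i; apply: Ix.
Qed.

Lemma subideal_nilpotent (k : fieldType) (d : nat) (I J : set 'M[k]_d) :
  J `<=` I -> is_nilpotent I -> is_nilpotent J.
Proof. by move=> JI [p nilI]; exists p => x Jx; apply: nilI => i; apply: JI. Qed.

Lemma mulr_scalemx (k : fieldType) (d : nat) (a : k) (g x : 'M[k]_d) :
  g * (a *: x) = a *: (g * x).
Proof. exact/esym/scalemxAr. Qed.

(** In a simple left ideal [L i] the vectors killed by [I] form a left ideal, which is
nonzero by [nilpotent_annihilator] and hence all of [L i]. So [I] kills the sum of
the [L i], which contains the identity. *)
Lemma semisimple_nilpotent_ideal (k : fieldType) (d : nat)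
    (B I : set 'M[k]_d) :
  semisimple B -> is_ideal B I -> is_nilpotent I -> forall x, I x -> x = 0.
Proof.
move=> [[e [Be eB]] [r [L [simL _ defB]]]] [IB I0 Ilin Imul] nilI.
have kill i x y : I x -> y \in L i -> x * y = 0.
  have [[LB Lmul] Ln0 Lmin] := simL i.
  (* The annihilator of [I] in [L i]. *)
  pose P : set 'M[k]_d := [set v | v \in L i /\ forall g, I g -> g * v = 0].
  have [|a u v [Lu u0] [Lv v0]|W WP] := @vspace_of_set _ _ P.
  - by split=> [|g _]; rewrite ?mem0v ?mulr0.
  - split=> [|g Ig]; first by rewrite rpredD ?rpredZ.
    by rewrite mulrDr mulr_scalemx u0 // v0 // scaler0 addr0.
  have Wleft : left_ideal B W.
    split=> [v /WP[Lv _]|b v Bb /WP[Lv v0]]; first exact: LB.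
    apply/WP; split=> [|g Ig]; first exact: Lmul.
    by rewrite mulrA v0 //; case: (Imul g b).
  have /(Lmin W Wleft) [W0|WL Ix Ly] : (W <= L i)%VS.
  - by apply/subvP => v /WP[].
  - have vL : vpick (L i) \notin 0%VS.
      by rewrite memv0 vpick0; apply/eqP.
    have [|v [Lv v0 Iv]] := nilpotent_annihilator (P := [set` L i]) nilI _
      (memv_pick (L i)) vL.
      by move=> g v /IB Bg Lv; apply: Lmul.
    case/negP: v0; rewrite -W0; apply/WP; split=> // g Ig.
    by apply/eqP; rewrite -memv0; apply: Iv.
  - by move: Ly; rewrite -WL => /WP[_]; apply.
move=> x Ix; rewrite -(proj2 (eB x (IB x Ix))).
have : e \in (\sum_(i < r) L i)%VS by move: Be; rewrite {1}defB.
move=> /memv_sumP[v Lv ->]; rewrite mulr_sumr big1 // => i _.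
by apply: (kill i) => //; apply: Lv.
Qed.

(** For a maximal left ideal [L], the left ideal [{v in B | J v <= L}] contains [L], and
strictly so by [nilpotent_annihilator]. Hence it is [B], it contains [1], and
[J = J 1 <= L]. *)
Lemma nilpotent_ideal_radical (k : fieldType) (d : nat) (B J : set 'M[k]_d) :
    (forall (a : k) x y, B x -> B y -> B (a *: x + y)) -> mul_closed B -> B 1 ->
  is_ideal B J -> is_nilpotent J -> J `<=` radical B.
Proof.
move=> Blin Bmul B1 [JB J0 Jlin Jmul] nilJ x Jx; split; first exact: JB.
move=> L [[LB Lmul] LneB Lmax].
pose P : set 'M[k]_d := [set v | B v /\ forall g, J g -> g * v \in L].
have [|a u v [Bu uL] [Bv vL]|W WP] := @vspace_of_set _ _ P.
- by split=> [|g _]; [exact: JB | rewrite mulr0 mem0v].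
- split=> [|g Jg]; first exact: Blin.
  by rewrite mulrDr mulr_scalemx rpredD ?rpredZ ?uL ?vL.
have Wleft : left_ideal B W.
  split=> [v /WP[]|b v Bb /WP[Bv vL]] //.
  apply/WP; split=> [|g Jg]; first exact: Bmul.
  by rewrite mulrA vL //; case: (Jmul g b).
have LW : (L <= W)%VS.
  apply/subvP=> v Lv; apply/WP; split=> [|g /JB Bg]; [exact: LB | exact: Lmul].
have [WL|WB] := Lmax W Wleft LW; last first.
  have : [set` W] 1 by rewrite WB.
  by move=> /WP[_ /(_ _ Jx)]; rewrite mulr1.
have L1 : 1 \notin L.
  apply/negP => L1; apply: LneB; apply/seteqP; split=> // b Bb /=.
  by rewrite -[b]mulr1; apply: Lmul.
have [|v [Bv vL Jv]] := nilpotent_annihilator (P := B) nilJ _ B1 L1.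
  by move=> g v /JB Bg; apply: Bmul.
by case/negP: vL; rewrite -WL; apply/WP.
Qed.

(** The vectors killed by [tau @` I] form a submodule, since [I] is a right ideal; it is
nonzero because [tau @` I] is nilpotent and [m > 0]. *)
Lemma irreducible_kills_nilpotent (k : fieldType) (A : algType k) (m : nat)
    (tau : {lrmorphism A -> 'M[k]_m}) (I : set A) :
    irreducible_rep tau -> (forall a b, I a -> I (a * b)) ->
  is_nilpotent (tau @` I) -> forall a, I a -> tau a = 0.
Proof.
move=> [m0 irr] Imul nilI.
pose P : set 'cV[k]_m := [set v | forall a, I a -> tau a *m v = 0].
have [a _|a u v u0 v0 b Ib|X XP] := @vspace_of_set _ _ P.
- by rewrite mulmx0.
- by rewrite mulmxDr -scalemxAr u0 // v0 // scaler0 addr0.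
have Xsub : submodule tau X.
  move=> b u /XP u0; apply/XP => a Ia.
  have -> : tau a *m (tau b *m u) = tau (a * b) *m u.
    by rewrite rmorphM mulmxA.
  by apply: u0; apply: Imul.
have [X0|XT a Ia] := irr X Xsub; last first.
  apply/matrixP => i j.
  have /XP/(_ a Ia)/matrixP/(_ i 0) : delta_mx j 0 \in X by rewrite XT memvf.
  by rewrite -colE !mxE.
have n0 : (const_mx 1 : 'cV[k]_m) \notin 0%VS.
  rewrite memv0; apply/eqP => /matrixP/(_ (Ordinal m0) 0) /eqP.
  by rewrite !mxE oner_eq0.
have [//|v [_ /negP vX Iv]] := nilpotent_annihilator (P := setT) nilI _ Logic.I n0.
case: vX; rewrite -X0; apply/XP => a Ia; apply/eqP; rewrite -memv0.
by apply: Iv; exists a.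
Qed.

(** * The order on contents *)

Lemma revlex_irr N n (w : word N n) : revlex w w = false.
Proof. by apply/existsP => -[j]; rewrite ltnn. Qed.

Lemma revlex_trans N n : transitive (@revlex N n).
Proof.
move=> v w u /existsP[i /andP[wv /forallP eqwv]].
move=> /existsP[j /andP[vu /forallP eqvu]].
have eqA (l : 'I_n) : (i < l)%N -> tnth w l = tnth v l.
  by move=> il; apply/eqP; move: (eqwv l); rewrite il.
have eqB (l : 'I_n) : (j < l)%N -> tnth v l = tnth u l.
  by move=> jl; apply/eqP; move: (eqvu l); rewrite jl.
apply/existsP; case: (ltngtP i j) => [ij|ji|/val_inj ij].
- exists j; rewrite eqA // vu; apply/forallP => l; apply/implyP => jl.
  by rewrite eqA ?eqB // (ltn_trans ij).
- exists i; rewrite -eqB // wv; apply/forallP => l; apply/implyP => il.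
  by rewrite eqA ?eqB // (ltn_trans ji).
- subst j; exists i; rewrite (ltn_trans wv vu); apply/forallP => l.
  by apply/implyP => il; rewrite eqA ?eqB.
Qed.

Lemma first_word_uniq N n (l : content_set N n) (w v : word N n) :
  first_word l w -> first_word l v -> w = v.
Proof.
move=> /andP[cw /forallP fw] /andP[cv /forallP fv].
apply/eqP; apply: contraT => ne.
move: (fw v) (fv w); rewrite cw cv /= eq_sym ne /= => wv vw.
by rewrite -(revlex_irr w) (revlex_trans wv vw).
Qed.

Lemma content_lt_irr N n (l : content_set N n) : content_lt l l = false.
Proof.
apply/existsP => -[w /existsP[v /and3P[lw lv]]].
by rewrite (first_word_uniq lw lv) revlex_irr.
Qed.

Lemma content_lt_trans N n (l m p : content_set N n) :
  content_lt l m -> content_lt m p -> content_lt l p.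
Proof.
move=> /existsP[w /existsP[v /and3P[lw mv wv]]].
move=> /existsP[v' /existsP[u /and3P[mv' pu vu]]].
rewrite -(first_word_uniq mv mv') in vu.
apply/existsP; exists w; apply/existsP; exists u.
by rewrite lw pu (revlex_trans wv vu).
Qed.

Lemma content_le_lt_trans N n (l m p : content_set N n) :
  content_le l m -> content_lt m p -> content_lt l p.
Proof. by case/orP=> [/eqP-> //|]; apply: content_lt_trans. Qed.

Lemma content_lt_le_trans N n (l m p : content_set N n) :
  content_lt l m -> content_le m p -> content_lt l p.
Proof. by move=> lm /orP[/eqP<- //|]; apply: content_lt_trans. Qed.

Lemma letter_count_nseq N n (i j : 'I_N) :
  letter_count (nseq_tuple n i) j = if i == j then n else 0%N.
Proof.
rewrite ffunE; case: eqP => [->|ne].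
  rewrite -[RHS]card_ord; apply: eq_card => l; rewrite !inE.
  by rewrite tnth_nseq eqxx.
apply: eq_card0 => l; rewrite !inE tnth_nseq.
exact/eqP.
Qed.

(** A constant word is the only word of its content. *)
Lemma first_word_nseq N n (i : 'I_N) :
  first_word (content (nseq_tuple n i)) (nseq_tuple n i).
Proof.
rewrite /first_word eqxx; apply/forallP => v; apply/implyP => /eqP/(congr1 sval).
move=> /= eqv; apply/implyP => /eqP[]; apply: eq_from_tnth => l.
have eqA : #|[pred j | tnth v j == i]| = #|'I_n|.
  by rewrite card_ord; have := letter_count_nseq n i i; rewrite eqxx -eqv ffunE.
have := subset_cardP eqA (subset_predT _) l.
by rewrite !inE tnth_nseq => /eqP.
Qed.

(** The words [0 ... 0] and [1 ... 1] have comparable contents by their last letters. *)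
Lemma exists_content_lt N n : (1 < N)%N -> (0 < n)%N ->
  exists w v : word N n, content_lt (content w) (content v).
Proof.
move=> N1 n0; pose i0 := Ordinal (ltnW N1); pose i1 := Ordinal N1.
exists (nseq_tuple n i0), (nseq_tuple n i1).
apply/existsP; exists (nseq_tuple n i0); apply/existsP.
exists (nseq_tuple n i1); rewrite !first_word_nseq /=.
have n1 : (n.-1 < n)%N by rewrite prednK.
apply/existsP; exists (Ordinal n1); rewrite !tnth_nseq /=.
apply/forallP => l; apply/implyP.
by rewrite ltnNge -ltnS prednK // ltn_ord.
Qed.

(** The height of a word counts the words of strictly smaller content. *)
Lemma exists_height N n : exists h : word N n -> nat,
  (forall w v, content_lt (content w) (content v) -> (h w < h v)%N) /\
  (forall w, (h w < wdim N n)%N).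
Proof.
pose below w := [pred u : word N n | content_lt (content u) (content w)].
have notin_below w : w \notin below w by rewrite inE content_lt_irr.
exists (fun w => #|below w|); split=> [w v lt_wv|w].
  apply: proper_card; apply/fintype.properP; split.
    apply/fintype.subsetP => u lt_uw.
    exact: (content_lt_trans (lt_uw : content_lt _ _) lt_wv).
  by exists w; [exact: lt_wv | exact: notin_below].
rewrite -[X in (_ < X)%N](cardC (pred1 w)) card1 add1n ltnS.
apply/subset_leq_card/fintype.subsetP => u u_below; rewrite !inE.
by apply: contraTneq u_below => ->; exact: notin_below.
Qed.

(** * Glue and de-gluing of matrices *)

Section Words.
Variables (k : fieldType) (N n : nat).
Local Notation d := (wdim N n).
Implicit Types (M : 'M[k]_d) (w v : word N n).

Lemma entryP M M' : (forall w v, entry M w v = entry M' w v) -> M = M'.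
Proof.
move=> eqM; apply/matrixP => i j.
by move: (eqM (enum_val i) (enum_val j)); rewrite /entry !enum_valK.
Qed.

Lemma entry_mul M M' w v :
  entry (M * M') w v = \sum_u entry M w u * entry M' u v.
Proof.
by rewrite /entry mxE (reindex (@enum_rank _)) //; apply/onW_bij/enum_rank_bij.
Qed.

Lemma entry_mul_neq0 M M' w v : entry (M * M') w v != 0 ->
  exists u, entry M w u != 0 /\ entry M' u v != 0.
Proof.
move=> neq0; apply: contrapT => none; case/eqP: neq0; rewrite entry_mul.
apply: big1 => u _; have [->|Mwu] := eqVneq (entry M w u) 0; rewrite ?mul0r //.
have [->|M'uv] := eqVneq (entry M' u v) 0; rewrite ?mulr0 //.
by case: none; exists u.
Qed.

Lemma entry_lin (a : k) M M' w v :
  entry (a *: M + M') w v = a * entry M w v + entry M' w v.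
Proof. by rewrite /entry !mxE. Qed.

Lemma entry0 w v : entry (0 : 'M[k]_d) w v = 0.
Proof. by rewrite /entry mxE. Qed.

Lemma entry1 w v : entry (1 : 'M[k]_d) w v = (w == v)%:R.
Proof. by rewrite /entry mxE (inj_eq enum_rank_inj). Qed.

Lemma entry_deglue M w v : entry (deglue M) w v =
  if content_lt (content w) (content v) then 0 else entry M w v.
Proof. by rewrite /entry mxE !enum_rankK. Qed.

Lemma glueE M :
  glue M <-> forall w v, entry M w v != 0 -> content_lt (content w) (content v).
Proof.
split=> [[gM M0] w v neq0|ltM].
  case/orP: (gM w v neq0) => // /eqP eqc.
  by rewrite M0 ?eqxx // in neq0.
split=> [w v /ltM lt_wv|w v eqc]; first by apply/orP; right.
by apply/eqP; apply: contraT => /ltM; rewrite eqc content_lt_irr.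
Qed.

Lemma glue_ideal : is_ideal (@Matchg k N n) (@glue k N n).
Proof.
split=> [M []//||a M M' /glueE gM /glueE gM'|M M' /glueE gM gM'].
- by apply/glueE => w v; rewrite entry0 eqxx.
- apply/glueE => w v; rewrite entry_lin.
  have [->|/gM //] := eqVneq (entry M w v) 0.
  by rewrite mulr0 add0r => /gM'.
- split; apply/glueE => w v /entry_mul_neq0[u []].
    by move=> /gM' wu /gM; apply: content_le_lt_trans.
  by move=> /gM wu /gM'; apply: content_lt_le_trans.
Qed.

(** A nonzero entry of a product of [q] glue matrices raises the height by at least
[q], and heights stay below the number of words. *)
Lemma glue_nilpotent : is_nilpotent (@glue k N n).
Proof.
have [h [h_lt h_max]] := exists_height N n.
exists d => x glx; apply: entryP => w v; rewrite entry0.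
(* Indexing the factors by all natural numbers allows induction on the length of
   the product. *)
pose y i := if insub i is Some j then x j else 0.
have gly i : glue (y i).
  by rewrite /y; case: insubP => // _; case: glue_ideal.
have -> : \prod_(i < d) x i = \prod_(i < d) y i.
  by apply: eq_bigr => i _; rewrite /y valK.
have height q u : entry (\prod_(i < q) y i) w u != 0 ->
    (h w + q <= h u)%N.
  elim: q u => [|q IHq] u.
    rewrite big_ord0 entry1 addn0.
    by have [-> _|_] := eqVneq w u; [exact: leqnn | rewrite eqxx].
  rewrite big_ord_recr => /entry_mul_neq0[u' [/IHq hu']].
  move=> /(proj1 (glueE _) (gly q))/h_lt.
  by rewrite addnS; apply: leq_ltn_trans.
apply/eqP; apply: contraT => /height; rewrite leqNgt.
by rewrite ltn_addl ?h_max.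
Qed.

(** A product of an entry at [(w, u)] and one at [(u, v)] contributes to a CC position
[(w, v)] only if the content of [u] lies between two equal contents, so that both
factors sit at CC positions. At a glue position
one of the two is glue, and is erased by de-gluing. *)
Lemma deglue_mul M M' :
  Matchg M -> Matchg M' -> deglue (M * M') = deglue M * deglue M'.
Proof.
move=> gM gM'; apply: entryP => w v.
rewrite entry_deglue !entry_mul; case: ifP => [lt_wv|ge_wv].
  rewrite big1 // => u _; rewrite !entry_deglue.
  case: ifP => [_|wu]; rewrite ?mul0r //; case: ifP => [_|uv]; rewrite ?mulr0 //.
  have [->|/gM] := eqVneq (entry M w u) 0; rewrite ?mul0r // /content_le wu orbF.
  have [->|/gM'] := eqVneq (entry M' u v) 0; rewrite ?mulr0 // /content_le uv orbF.
  by move=> /eqP uv' /eqP wu'; rewrite wu' uv' content_lt_irr in lt_wv.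
apply: eq_bigr => u _; rewrite !entry_deglue.
case: ifP => [wu|_].
  have [->|/gM' uv] := eqVneq (entry M' u v) 0; rewrite ?mulr0 ?mul0r //.
  by rewrite (content_lt_le_trans wu uv) in ge_wv.
case: ifP => // uv; have [->|/gM wu] := eqVneq (entry M w u) 0.
  by rewrite !mul0r.
by rewrite (content_le_lt_trans wu uv) in ge_wv.
Qed.

Lemma deglue1 : deglue (1 : 'M[k]_d) = 1.
Proof.
apply: entryP => w v; rewrite entry_deglue entry1.
by have [->|_] := eqVneq w v; rewrite ?content_lt_irr //; case: ifP.
Qed.

Lemma deglue_Match M : Matchg M -> Match (deglue M).
Proof.
move=> gM w v; rewrite entry_deglue; case: ifP; rewrite ?eqxx // => ge_wv.
by move=> /gM; rewrite /content_le ge_wv orbF => /eqP.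
Qed.

Lemma deglue_eq0 M : Matchg M -> deglue M = 0 <-> glue M.
Proof.
move=> gM; split=> [KM0|/glueE glM].
  split=> // w v eqc; have := entry_deglue M w v.
  by rewrite KM0 entry0 eqc content_lt_irr.
apply: entryP => w v; rewrite entry_deglue entry0; case: ifP => // ge_wv.
by apply/eqP; apply: contraFT ge_wv => /glM.
Qed.

Lemma sub_deglue_glue M : Matchg M -> glue (M - deglue M).
Proof.
move=> gM; apply/glueE => w v.
rewrite -scaleN1r addrC entry_lin mulN1r entry_deglue; case: ifP => // ge_wv.
by rewrite addNr eqxx.
Qed.

Lemma exists_glue_neq0 : (1 < N)%N -> (0 < n)%N ->
  exists M : 'M[k]_d, glue M /\ M <> 0.
Proof.
move=> N1 n0; have [w [v lt_wv]] := exists_content_lt N1 n0.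
exists (delta_mx (enum_rank w) (enum_rank v)); split.
  apply/glueE => w' v'; rewrite /entry mxE !(inj_eq enum_rank_inj).
  case: andP => [[/eqP-> /eqP->] _|_]; first exact: lt_wv.
  by move=> /eqP[].
move=> /matrixP/(_ (enum_rank w) (enum_rank v))/eqP.
by rewrite !mxE !eqxx oner_eq0.
Qed.

End Words.

(** * The Jordan-Hoelder theorem *)

Section JordanHolder.
Variables (k : fieldType) (d : nat).
Implicit Types (u w : nat -> {vspace 'cV[k]_d}).

(** Composition series as functions on the natural numbers. Values beyond the length
[r] are also submodules, which spares range conditions; the default value [0] of
[nth] has this property. *)
Definition module_chain (A : Type) (rho : A -> 'M[k]_d) u (r : nat) : Prop :=
  [/\ u 0 = 0%VS, u r = fullv, forall i, submodule rho (u i)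
    & forall i, (i < r)%N -> irreducible_factor rho (u i) (u i.+1)].

(** The common part [D] of [u i.+1] and [w j.+1] is nonzero in [u i.+1 / u i] and has
the same intersection with [u i] and with [w j]. For composition series these are
the pairs of factors that the Zassenhaus lemma matches. *)
Definition linked u w (i j : nat) : bool :=
  let D := (u i.+1 :&: w j.+1)%VS in
  [&& ~~ (D <= u i)%VS, (D :&: w j <= u i)%VS & (D :&: u i <= w j)%VS].

Lemma linked_sym u w i j : linked u w i j -> linked w u j i.
Proof.
move=> /and3P[Du Dw uD]; rewrite /linked capvC uD Dw !andbT.
apply: contra Du => Dw'; apply: subv_trans Dw.
by rewrite subv_cap subvv.
Qed.

Variables (A : Type) (rho : A -> 'M[k]_d).

Lemma chain_mono u r i j : module_chain rho u r -> (i <= j <= r)%N ->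
  (u i <= u j)%VS.
Proof.
case=> _ _ _ irr /andP[]; elim: j => [|j IHj].
  by rewrite leqn0 => /eqP->.
rewrite leq_eqVlt ltnS => /orP[/eqP-> //|ij] jr.
by apply: subv_trans (IHj ij (ltnW jr)) _; case: (irr j jr).
Qed.

(** For [j < j'] the intersection [D] for [j] lies in [w j'] and in the one for [j'],
hence in [u i]. *)
Lemma linked_uniq u w m i j j' : module_chain rho w m ->
    (j < m)%N -> (j' < m)%N ->
  linked u w i j -> linked u w i j' -> j = j'.
Proof.
move=> cw; wlog le_jj' : j j' / (j <= j')%N => [sym|].
  case/orP: (leq_total j j') => le_jj' jm j'm lj lj'; first exact: sym.
  exact/esym/sym.
move=> jm j'm /and3P[Du _ _] /and3P[_ Dw' _].
apply/eqP; move: le_jj'; rewrite leq_eqVlt => /orP[// | lt_jj'].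
case/negP: Du; apply: subv_trans Dw'.
have jj' : (w j.+1 <= w j')%VS by apply: (chain_mono cw); rewrite lt_jj' ltnW.
have j'j' : (w j' <= w j'.+1)%VS by apply: (chain_mono cw); rewrite leqnSn.
rewrite !subv_cap capvSl (subv_trans (capvSr _ _) jj').
by rewrite (subv_trans (capvSr _ _) (subv_trans jj' j'j')).
Qed.

Lemma submoduleI U V : submodule rho U -> submodule rho V ->
  submodule rho (U :&: V)%VS.
Proof. by move=> sU sV a x; rewrite !memv_cap => /andP[/sU-> /sV->]. Qed.

Lemma submoduleD U V : submodule rho U -> submodule rho V ->
  submodule rho (U + V)%VS.
Proof.
move=> sU sV a _ /memv_addP[x Ux [y Vy ->]].
by rewrite mulmxDr memv_add ?sU ?sV.
Qed.

Lemma irreducible_fill U0 U1 D : submodule rho U0 -> submodule rho D ->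
    irreducible_factor rho U0 U1 -> (D <= U1)%VS -> ~~ (D <= U0)%VS ->
  (U0 + D)%VS = U1.
Proof.
move=> sU0 sD [le01 _ irr] DU1 DU0.
have [|||eqU0|//] := irr (U0 + D)%VS.
- exact: submoduleD.
- exact: addvSl.
- by rewrite subv_add le01.
by rewrite -eqU0 addvSr in DU0.
Qed.

(** The [j] sought is the step at which [u i.+1 :&: w j] leaves [u i]. *)
Lemma linked_exists u w r m i : module_chain rho u r -> module_chain rho w m ->
  (i < r)%N -> exists2 j, (j < m)%N & linked u w i j.
Proof.
move=> [_ _ su irru] [w0 wm sw irrw] ir.
pose P j := ~~ (u i.+1 :&: w j <= u i)%VS.
have Pm : P m.
  rewrite /P wm capvf; apply/negP => le10.
  have [le01 ne _] := irru i ir; apply: ne.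
  by apply/eqP; rewrite eqEsubv le01.
case: (ex_minnP (ex_intro P m Pm)) => -[|j] Pj minj.
  by move: Pj; rewrite /P w0 capv0 sub0v.
have jm : (j < m)%N by apply: minj.
have Pj' : (u i.+1 :&: w j <= u i)%VS.
  by apply: contraT => /minj; rewrite ltnn.
exists j => //; rewrite /linked; move: (Pj); rewrite {1}/P => -> /=.
set D := (u i.+1 :&: w j.+1)%VS.
have [lejj _ _] := irrw j jm; have [leii _ _] := irru i ir.
apply/andP; split.
  by apply: subv_trans Pj'; rewrite capvS ?capvSl.
(* Otherwise [D :&: u i] fills [w j.+1] modulo [w j]. Then, by the modular law, [D] is
   spanned by [D :&: u i] and [D :&: w j], both contained in [u i]. *)
apply: contraT => notle; case/negP: Pj.
have fill : (w j + (D :&: u i))%VS = w j.+1.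
  apply: (irreducible_fill (sw j) _ (irrw j jm) _ notle).
    by apply: submoduleI => //; apply: submoduleI.
  exact: subv_trans (capvSl _ _) (capvSr _ _).
apply/subvP => x; rewrite memv_cap -fill => /andP[xu /memv_addP[y yw [z]]].
rewrite memv_cap => /andP[zD zu] def_x.
have yu : y \in u i.+1.
  have -> : y = x - z by rewrite def_x addrK.
  by rewrite rpredB // (subvP leii).
by rewrite def_x rpredD //; apply: (subvP Pj'); rewrite memv_cap yu.
Qed.

(** Both factors are isomorphic to [D] modulo the common intersection with [u i] and
[w j]. A projection onto [D] along [u i] induces the composite. *)
Lemma linked_factor_iso u w r m i j :
    module_chain rho u r -> module_chain rho w m -> (i < r)%N -> (j < m)%N ->
    linked u w i j ->
  factor_iso rho rho (u i) (u i.+1) (w j) (w j.+1).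
Proof.
move=> [_ _ su irru] [_ _ sw irrw] ir jm lij.
have := linked_sym lij => /and3P[Dw _ _]; move: lij Dw => /and3P[].
rewrite [(w _ :&: u _)%VS]capvC; set D := (u i.+1 :&: w j.+1)%VS.
move=> Du Dwu Duw Dw.
have sD : submodule rho D by apply: submoduleI.
have fillu : (u i + D)%VS = u i.+1.
  by apply: (irreducible_fill (su i) sD (irru i ir)); rewrite ?capvSl.
have fillw : (w j + D)%VS = w j.+1.
  by apply: (irreducible_fill (sw j) sD (irrw j jm)); rewrite ?capvSr.
pose phi := addv_pi1 D (u i).
have phiD x : phi x \in D by apply: memv_pi1.
have phiu x : x \in u i.+1 -> x - phi x \in u i.
  rewrite -fillu addvC => xDu.
  by rewrite -{1}(addv_pi1_pi2 xDu) addrC addKr memv_pi2.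
have Dphi x : x \in D -> x \in u i -> x \in w j.
  by move=> xD xu; apply: (subvP Duw); rewrite memv_cap xD.
exists phi; split.
- by apply/subvP => _ /memv_imgP[x _ ->]; apply: (subvP (capvSr _ _) _ (phiD x)).
- move=> x xu; apply/idP/idP => [phiw|xui].
    rewrite -(subrK (phi x) x) rpredD ?phiu //.
    by apply: (subvP Dwu); rewrite memv_cap phiD.
  by apply: Dphi => //; rewrite -(subKr x (phi x)) rpredB ?phiu.
- rewrite -fillw subv_add addvSr /=; apply/subvP => x xD.
  rewrite -(subrK (phi x) x) addrC; apply: memv_add.
    by apply: memv_img; apply: (subvP (capvSl _ _) _ xD).
  apply: Dphi; first exact: rpredB.
  by apply: phiu; apply: (subvP (capvSl _ _) _ xD).
- move=> a x xu; apply: Dphi; first by rewrite rpredB ?sD.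
  have -> : phi (rho a *m x) - rho a *m phi x =
      rho a *m (x - phi x) - (rho a *m x - phi (rho a *m x)).
    by rewrite mulmxBr opprB [RHS]addrC addrA subrK.
  by rewrite rpredB ?su ?phiu ?su.
Qed.

(** Injectivity in the other variable is [linked_uniq] with the two series exchanged. *)
Lemma linked_injection u w r m : module_chain rho u r -> module_chain rho w m ->
  exists f : 'I_r -> 'I_m, injective f /\ forall i : 'I_r, linked u w i (f i).
Proof.
move=> cu cw.
have ex (i : 'I_r) : exists j : 'I_m, linked u w i j.
  have [j jm lij] := linked_exists cu cw (ltn_ord i).
  by exists (Ordinal jm).
have [f lf] := fin_all_exists ex; exists f; split=> // i i' eqf.
apply: val_inj; apply: (linked_uniq cu (ltn_ord i) (ltn_ord i')).
  by apply: linked_sym (lf i).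
by rewrite eqf; apply: linked_sym (lf i').
Qed.

Lemma jordan_holder u w r m : module_chain rho u r -> module_chain rho w m ->
  r = m /\ exists p : {perm 'I_r}, forall i : 'I_r,
    factor_iso rho rho (u i) (u i.+1) (w (p i)) (w (p i).+1).
Proof.
move=> cu cw; have [f [injf lf]] := linked_injection cu cw.
have [g [injg _]] := linked_injection cw cu.
have eqrm : r = m.
  apply/eqP; rewrite eqn_leq; have := leq_card f injf; have := leq_card g injg.
  by rewrite !card_ord => -> ->.
case: m / eqrm cw f injf lf {g injg} => cw f injf lf; split=> //.
exists (perm injf) => i; rewrite permE.
exact: (linked_factor_iso cu cw).
Qed.

End JordanHolder.

(** The inclusion of [W0] in [W1] is needed for [psi] to send [W0] into [X0]. *)
Lemma factor_iso_trans (k : fieldType) (A : Type) (d e f : nat)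
    (rho : A -> 'M[k]_d) (sigma : A -> 'M[k]_e) (tau : A -> 'M[k]_f)
    U0 U1 W0 W1 X0 X1 :
    (W0 <= W1)%VS ->
    factor_iso rho sigma U0 U1 W0 W1 -> factor_iso sigma tau W0 W1 X0 X1 ->
  factor_iso rho tau U0 U1 X0 X1.
Proof.
move=> leW [phi [phiW phi0 phisurj philin]] [psi [psiX psi0 psisurj psilin]].
have phiU u : u \in U1 -> phi u \in W1.
  by move=> Uu; apply: (subvP phiW); apply: memv_img.
have psiW0 w : w \in W0 -> psi w \in X0.
  by move=> Ww; rewrite psi0 // (subvP leW).
exists (psi \o phi)%VF; split.
- by rewrite limg_comp; apply: subv_trans (limgS _ phiW) psiX.
- by move=> u Uu; rewrite comp_lfunE psi0 ?phi0 ?phiU.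
- apply/subvP => x /(subvP psisurj) /memv_addP[_ /memv_imgP[w Ww ->] [x0 Xx0 ->]].
  move/(subvP phisurj): Ww => /memv_addP[_ /memv_imgP[u Uu ->] [w0 Ww0 ->]].
  rewrite linearD /= -addrA memv_add ?rpredD ?psiW0 //.
  by rewrite -[psi _]comp_lfunE memv_img.
- move=> a u Uu; rewrite !comp_lfunE.
  rewrite -(subrK (psi (sigma a *m phi u)) (psi (phi _))) -addrA rpredD //.
    by rewrite -linearB psiW0 ?philin.
  by rewrite psilin ?phiU.
Qed.

(** * A composition series common to two representations *)

Section CommonSeries.
Variables (k : fieldType) (A : Type) (d : nat) (rho sigma : A -> 'M[k]_d).
Variable I : set 'M[k]_d.
Hypotheses (nilI : is_nilpotent I) (Irho : forall g a, I g -> I (g *m rho a)).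
Hypothesis subI : forall a, I (rho a - sigma a).

(** The last condition says that the identity induces an isomorphism of [W / U] as a
[rho]-module with [W / U] as a [sigma]-module. *)
Definition common_step (U W : {vspace 'cV[k]_d}) : Prop :=
  [/\ irreducible_factor rho U W, irreducible_factor sigma U W
    & forall a v, v \in W -> rho a *m v - sigma a *m v \in U].

Definition common_submodule U := submodule rho U /\ submodule sigma U.

(** On [U + X], with [X = {v | I v <= U}], the two representations agree modulo [U], so
they have the same submodules between [U] and [U + X]; a minimal one that is
strictly larger than [U] is the next term. It exists because [X] is not contained
in [U], by [nilpotent_annihilator]. *)
Lemma common_step_exists U : common_submodule U -> U <> fullv ->
  exists2 W, common_submodule W & common_step U W.
Proof.
move=> [sU sU'] /eqP neU.
pose P : set 'cV[k]_d := [set v | forall g, I g -> g *m v \in U].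
have [g _|a v v' Pv Pv' g Ig|X XP] := @vspace_of_set _ _ P.
- by rewrite mulmx0 mem0v.
- by rewrite mulmxDr -scalemxAr rpredD ?rpredZ ?Pv ?Pv'.
have sX : submodule rho X.
  by move=> a v /XP Pv; apply/XP => g Ig; rewrite mulmxA Pv //; apply: Irho.
have diff a v : v \in (U + X)%VS -> rho a *m v - sigma a *m v \in U.
  move=> /memv_addP[x Ux [y /XP Py ->]]; rewrite -mulmxBl mulmxDr.
  by rewrite rpredD ?Py // mulmxBl rpredB ?sU ?sU'.
pose Q W := [/\ submodule rho W, (U <= W)%VS, U != W & (W <= U + X)%VS].
pose dimQ m := `[< exists2 W, Q W & \dim W = m >].
have exQ : exists m, dimQ m.
  exists (\dim (U + X)%VS); apply/asboolP; exists (U + X)%VS => //; split=> //.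
  - exact: submoduleD.
  - exact: addvSl.
  apply: contra neU => /eqP eqU; apply/eqP/vspaceP => v; rewrite memvf.
  apply: contraT => vU.
  have [//|v' [_ v'U Iv']] := nilpotent_annihilator (P := setT) nilI _ Logic.I vU.
  by case/negP: v'U; rewrite eqU; apply: (subvP (addvSr _ _)); apply/XP.
case: (ex_minnP exQ) => m /asboolP[W [sW leUW neUW leWX] <-] minW.
have transfer V : (U <= V)%VS -> (V <= W)%VS ->
    submodule rho V <-> submodule sigma V.
  move=> leUV leVW; split=> sV a v Vv.
    rewrite -[sigma a *m v](subKr (rho a *m v)) rpredB ?sV //.
    by rewrite (subvP leUV) // diff // (subvP leWX) // (subvP leVW).
  rewrite -(subrK (sigma a *m v) (rho a *m v)) rpredD ?sV //.
  by rewrite (subvP leUV) // diff // (subvP leWX) // (subvP leVW).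
have irr V : submodule rho V -> (U <= V)%VS -> (V <= W)%VS -> V = U \/ V = W.
  move=> sV leUV leVW; have [->|neUV] := eqVneq U V; [by left | right].
  apply/eqP; rewrite -(dimv_leqif_eq leVW) eqn_leq dimvS //=.
  apply: minW; apply/asboolP; exists V => //; split=> //.
  exact: subv_trans leVW leWX.
exists W; first by split=> //; apply/transfer.
split.
- by split=> //; apply/eqP.
- split=> //; first exact/eqP.
  by move=> V sV leUV leVW; apply: irr => //; apply/transfer.
- by move=> a v Wv; apply: diff; apply: (subvP leWX).
Qed.

Lemma common_series_from U : common_submodule U ->
  exists s, [/\ forall W, W \in s -> common_submodule W,
    forall i, (i < size s)%N -> common_step (nth 0%VS (U :: s) i) (nth 0%VS s i)
  & last U s = fullv].
Proof.
have [q] := ubnP (\dim {:'cV[k]_d} - \dim U); elim: q U => // q IHq U leq sU.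
have [->|/eqP neU] := eqVneq U fullv; first by exists [::].
have [W sW stepW] := common_step_exists sU neU.
have lt_dim : (\dim U < \dim W)%N.
  have [[leUW neUW _] _ _] := stepW; rewrite (ltn_leqif (dimv_leqif_sup leUW)).
  by apply/negP => leWU; apply: neUW; apply/eqP; rewrite eqEsubv leUW.
have [|s [ss steps lasts]] := IHq W _ sW.
  rewrite ltnS in leq; apply: leq_trans leq; apply: ltn_sub2l => //.
  by apply: leq_trans lt_dim _; rewrite dimvS ?subvf.
exists (W :: s); split=> //; last by case=> [|i] //; apply: steps.
by move=> V; rewrite inE => /orP[/eqP->|/ss].
Qed.

Lemma composition_series_chain (B : Type) (tau : B -> 'M[k]_d) s :
  composition_series tau s ->
  module_chain tau (nth 0%VS (0%VS :: s)) (size s).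
Proof.
case=> sub irr lasts; split=> //; first by rewrite -last_nth.
have sub0 : submodule tau 0%VS.
  by move=> a u; rewrite memv0 => /eqP->; rewrite mulmx0 mem0v.
move=> i; case: (ltnP i (size (0%VS :: s))) => [lt_is|ge_is]; last first.
  by rewrite nth_default.
by case: i lt_is => [|i] //= lt_is; apply: sub; apply: mem_nth.
Qed.

(** The bijection is the composite of the Jordan-Hoelder bijection from [s] to the common
series for [rho] and the one from the common series to [t] for [sigma]. *)
Lemma common_same_factors : same_irreducible_factors rho sigma.
Proof.
have sub0 : common_submodule 0%VS.
  by split=> a u; rewrite memv0 => /eqP->; rewrite mulmx0 mem0v.
have [s0 [sub0s step0 last0]] := common_series_from sub0.
have /composition_series_chain crho : composition_series rho s0.
  by split=> // [U /sub0s[]|i /step0[]].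
have /composition_series_chain csigma : composition_series sigma s0.
  by split=> // [U /sub0s[]|i /step0[]].
move=> s t /composition_series_chain cs /composition_series_chain ct.
have [eqs [p isop]] := jordan_holder cs crho.
have [eqt [q isoq]] := jordan_holder csigma ct.
rewrite -eqs in eqt csigma q isoq step0; split=> //.
exists (p * q)%g => i; rewrite permM.
have [[le01 ne01 _] _ diff] := step0 _ (ltn_ord (p i)).
apply: (factor_iso_trans le01 _ (isoq (p i))).
apply: (factor_iso_trans le01 (isop i)).
(* It remains to pass from [rho] to [sigma] on a factor of the common series. *)
exists \1%VF; split.
- by rewrite lim1g.
- by move=> u _; rewrite id_lfunE.
- by rewrite lim1g addvSl.
- by move=> a u Uu; rewrite !id_lfunE; apply: diff.
Qed.

End CommonSeries.

(** * De-gluing representations *)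

Section Degluing.
Variables (k : fieldType) (N n : nat) (A : algType k).
Variable rho : {lrmorphism A -> 'M[k]_(wdim N n)}.
Hypothesis grho : forall a, Matchg (rho a).

Definition deglued_fun (a : A) : 'M[k]_(wdim N n) := deglue (rho a).

Lemma deglued_linear : linear deglued_fun.
Proof. by move=> a x y; rewrite /deglued_fun !linearP. Qed.

Lemma deglued_monoid : monoid_morphism deglued_fun.
Proof.
split=> [|x y]; first by rewrite /deglued_fun rmorph1 deglue1.
by rewrite /deglued_fun rmorphM; apply: deglue_mul; apply: grho.
Qed.

Lemma deglued_exists : exists Krho : {lrmorphism A -> 'M[k]_(wdim N n)},
  forall a, Krho a = deglue (rho a).
Proof.
pose lin := GRing.isLinear.Build _ _ _ _ deglued_fun deglued_linear.
pose mon := GRing.isMonoidMorphism.Build _ _ deglued_fun deglued_monoid.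
pose K : {lrmorphism A -> 'M[k]_(wdim N n)} := HB.pack deglued_fun lin mon.
by exists K.
Qed.

End Degluing.

Theorem mainTheorem2 (k : fieldType) (N : nat) :
  (* (I) *)
  (forall n : nat,
     [/\ is_ideal (@Matchg k N n) (@glue k N n),
         is_nilpotent (@glue k N n),
         (1 < N)%N -> (1 < n)%N -> ~ semisimple (@Matchg k N n)
       & forall M : {vspace 'M[k]_(wdim N n)},
           [set` M] `<=` @Matchg k N n ->
           mul_closed [set` M] ->
           (\dim (linfun (@deglue k N n) @: M) < \dim M)%N ->
           ~ semisimple [set` M]])
  /\
  (* (II) *)
  (forall (n : nat) (A : algType k)
          (rho : {lrmorphism A -> 'M[k]_(wdim N n)}),
     (forall a, Matchg (rho a)) ->
     exists Krho : {lrmorphism A -> 'M[k]_(wdim N n)},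
       [/\ (forall a, Krho a = deglue (rho a)) /\ (forall a, Match (Krho a)),
           exists J : set 'M[k]_(wdim N n),
             [/\ is_ideal (range rho) J,
                 J `<=` radical (range rho)
               & quotient_map (@deglue k N n) (range rho) J (range Krho)],
           same_irreducible_factors rho Krho
         & forall (m : nat) (tau : {lrmorphism A -> 'M[k]_m}),
             irreducible_rep tau ->
             (factors_through rho tau <-> factors_through Krho tau)]).
Proof.
split=> [n|n A rho grho].
  split=> [||N1 n1 ss|M gM Mmul ltdim ss].
  - exact: glue_ideal.
  - exact: glue_nilpotent.
  - have [M [glM M0]] := exists_glue_neq0 k N1 (ltnW n1).
    apply: M0; apply: (semisimple_nilpotent_ideal ss) glM.
      exact: glue_ideal.
    exact: glue_nilpotent.
  pose I : set 'M[k]_(wdim N n) := [set x | x \in M /\ glue x].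
  have [gI gl0 gllin glmul] := @glue_ideal k N n.
  have idI : is_ideal [set` M] I.
    split=> [x []//||a x y [Mx glx] [My gly]|x b [Mx glx] Mb].
    - by split=> //; rewrite mem0v.
    - by split; [rewrite rpredD ?rpredZ | apply: gllin].
    - have [glbx glxb] := glmul x b glx (gM b Mb).
      by split; split=> //; apply: Mmul.
  have nilI : is_nilpotent I.
    by apply: subideal_nilpotent (@glue_nilpotent k N n) => x [].
  (* A drop in dimension means a nonzero kernel, and that kernel is the nilpotent
     ideal [I]. *)
  have := limg_ker_dim (linfun (@deglue k N n)) M.
  suff -> : (M :&: lker (linfun (@deglue k N n)))%VS = 0%VS.
    by rewrite dimv0 add0n => eqdim; rewrite eqdim ltnn in ltdim.
  apply/eqP; rewrite -subv0; apply/subvP => x.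
  rewrite memv_cap memv_ker lfunE /= => /andP[Mx /eqP Kx0]; rewrite memv0.
  apply/eqP; apply: (semisimple_nilpotent_ideal ss idI nilI).
  by split=> //; apply/deglue_eq0 => //; apply: gM.
have [Krho KrhoE] := deglued_exists grho.
have [gI gl0 gllin glmul] := @glue_ideal k N n.
have nilg := @glue_nilpotent k N n.
have Bg x : range rho x -> Matchg x by case=> a _ <-.
have Blin (a : k) x y : range rho x -> range rho y -> range rho (a *: x + y).
  by move=> [b _ <-] [c _ <-]; exists (a *: b + c) => //; rewrite linearP.
have Bmul : mul_closed (range rho).
  by move=> _ _ [a _ <-] [b _ <-]; exists (a * b) => //; rewrite rmorphM.
have B1 : range rho 1 by exists 1 => //; rewrite rmorph1.
exists Krho; split.
- by split=> // a; rewrite KrhoE; apply: deglue_Match.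
- exists [set x | range rho x /\ glue x].
  have idJ : is_ideal (range rho) [set x | range rho x /\ glue x].
    split=> [x []//||a x y [Bx glx] [By gly]|x b [Bx glx] Bb].
    - by split=> //; exists 0 => //; rewrite linear0.
    - by split; [apply: Blin | apply: gllin].
    - have [glbx glxb] := glmul x b glx (Bg b Bb).
      by split; split=> //; apply: Bmul.
  split=> //.
    apply: nilpotent_ideal_radical => //.
    by apply: subideal_nilpotent nilg => x [].
  split.
  - by move=> a x y _ _; rewrite linearP.
  - by move=> x y /Bg gx /Bg gy; apply: deglue_mul.
  - apply/seteqP; split=> [_ [_ [a _ <-] <-]|_ [a _ <-]].
      by exists a.
    by exists (rho a); [exists a | rewrite KrhoE].
  - move=> x Bx; rewrite deglue_eq0; last exact: Bg.
    by split=> [//|[]].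
- apply: (common_same_factors nilg) => [g a glg|a].
    by have [_] := glmul g (rho a) glg (grho a).
  by rewrite KrhoE; apply: sub_deglue_glue.
- move=> m tau irr; split=> fact a; last first.
    by move=> rho0; apply: fact; rewrite KrhoE rho0 linear0.
  move=> Krho0; pose I : set A := [set b | Krho b = 0].
  apply: (irreducible_kills_nilpotent (I := I) irr) => // [b c Ib|].
    by rewrite /I /= rmorphM [X in X * _](_ : _ = 0) ?mul0r.
  have [p nilp] := nilg; exists p => x Ix.
  have ex i : exists b : A, Krho b = 0 /\ tau b = x i.
    by have [b Kb <-] := Ix i; exists b.
  have [b bP] := fin_all_exists ex.
  (* A product of elements [tau b] is [tau] of the product, and [rho] sends that product
     to a product of glue matrices, which is zero; [tau] factors through [rho]. *)
  rewrite -(eq_bigr _ (fun i _ => proj2 (bP i))) -rmorph_prod.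
  apply: fact; rewrite rmorph_prod; apply: nilp => i.
  apply/deglue_eq0; first exact: grho.
  by rewrite -KrhoE; case: (bP i).
Qed.
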